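(* Let $(P,\leq)=(P,\land,\lor)$ be a lattice in which every principal order ideal $\{y\in P: y\le x\}$ is finite, and let $f:P\to\mathbb{C}$ be semimultiplicative with $f(x)\neq 0$ for all $x\in P$. Let $n\ge 3$ and let $S=\{x_1,\ldots,x_n\}$ be a meet closed subset of $P$ with distinct elements, indexed so that $x_i<x_j\Rightarrow i<j$, such that $x_i\land x_j=x_1$ for all distinct $i,j\in\{1,\ldots,n-1\}$ and $x_1\lor x_2\lor\cdots\lor x_{n-1}\le x_n$. Then the join matrix $[S]_f$ is invertible if and only if $f(x_k)\neq f(x_1)$ for $k=2,3,\ldots,n-1$ and $$\frac{1}{f(x_n)}\neq\Big(\sum_{k=2}^{n-1}\frac{1}{f(x_k)}\Big)-\frac{n-3}{f(x_1)}.$$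
   Context: $f$ is semimultiplicative if $f(x)f(y)=f(x\land y)f(x\lor y)$ for all $x,y\in P$. A subset $S$ is meet closed if $x,y\in S\Rightarrow x\land y\in S$. The join matrix $[S]_f$ is the $n\times n$ matrix with $(i,j)$ entry $f(x_i\lor x_j)$. *)

(* Defs.v *)
From mathcomp Require Import all_boot all_order all_algebra.
From mathcomp Require Import all_classical reals.
From mathcomp Require Import complex.

Set Implicit Arguments.
Unset Strict Implicit.
Unset Printing Implicit Defensive.

Import Order.TTheory GRing.Theory Num.Theory.
Local Open Scope ring_scope.

Definition finite_principal_ideals (d : Order.disp_t) (P : latticeType d) :=
  forall x : P, finite_set [set y : P | (y <= x)%O]%classic.

Definition semimultiplicative (d : Order.disp_t) (P : latticeType d)
    (C : fieldType) (f : P -> C) :=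
  forall x y : P, f x * f y = f (Order.meet x y) * f (Order.join x y).

Definition meet_closed_set (d : Order.disp_t) (P : latticeType d)
    (S : classical_sets.set P) :=
  forall x y : P, S x -> S y -> S (Order.meet x y).

Definition join_matrix (d : Order.disp_t) (P : latticeType d)
    (C : fieldType) (f : P -> C) (n : nat) (x : 'I_n -> P) : 'M[C]_n :=
  \matrix_(i < n, j < n) f (Order.join (x i) (x j)).

Lemma first_ord_subproof n : (3 <= n -> 0 < n)%N.
Proof. by case: n. Qed.

Lemma last_ord_subproof n : (3 <= n -> n.-1 < n)%N.
Proof. by case: n. Qed.

(* Families x_1, ..., x_n are indexed from 0: x_1 is x (first_ord hn) and
   x_n is x (last_ord hn). *)
Definition first_ord n (hn : (3 <= n)%N) : 'I_n :=
  Ordinal (first_ord_subproof hn).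

Definition last_ord n (hn : (3 <= n)%N) : 'I_n :=
  Ordinal (last_ord_subproof hn).

(* Main.v *)
Require Import Defs.
From mathcomp Require Import all_boot all_order all_algebra.
From mathcomp Require Import all_classical reals.
From mathcomp Require Import complex.
From mathcomp Require Import ring.

Set Implicit Arguments.
Unset Strict Implicit.
Unset Printing Implicit Defensive.

Import Order.TTheory GRing.Theory Num.Theory.
Local Open Scope ring_scope.

(** Put [g := 1 / f]. Semimultiplicativity reads
    [f (x \/ y) = f x * g (x /\ y) * f y], so the join matrix of [f] is the meet
    matrix of [g] multiplied on both sides by an invertible diagonal matrix.
    The hypotheses on [S] make the entries of this meet matrix explicit: the
    last row and column list the values of [g], and elsewhere the off-diagonal
    entries are [g x_1]. With [s] the sum of the entries of a row vector [v],
    the kernel equations [v G = 0] become [s = 0],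
    [(g x_j - g x_1) (v_j + v_n) = 0] for [1 < j < n], and
    [\sum_i v_i * g x_i = 0]. If no [g x_j - g x_1] vanishes, the solutions of
    the first two are the multiples of [(n - 3, -1, ..., -1, 1)], and the last
    equation decides whether that vector is in the kernel. *)

Lemma unitmx_kerP (F : fieldType) (n : nat) (A : 'M[F]_n) :
  A \in unitmx <-> (forall v : 'rV[F]_n, v *m A = 0 -> v = 0).
Proof.
split=> [Au v vA0|kerA]; first by rewrite -[v](mulmxK Au) vA0 mul0mx.
rewrite -row_free_unit -kermx_eq0; apply/rowV0P => v /sub_kermxP; exact: kerA.
Qed.

Lemma sum_ordD2 (V : zmodType) (n : nat) (o l : 'I_n) (h : 'I_n -> V) :
  o != l ->
  \sum_i h i = h o + h l + \sum_(i | (i != o) && (i != l)) h i.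
Proof. by move=> ol; rewrite (bigD1 o) //= (bigD1 l) 1?eq_sym //= addrA. Qed.

Lemma sumr_mul_delta (F : nzRingType) (n : nat) (v : 'I_n -> F) (j : 'I_n) :
  \sum_i v i * (i == j)%:R = v j.
Proof.
rewrite (bigD1 j) //= eqxx mulr1 big1 ?addr0 // => i /negbTE ->.
by rewrite mulr0.
Qed.

(** The meet matrix of [g] on elements with least one at [o], greatest one at [l], and any two
    distinct others meeting in the least one. *)
Definition fan_matrix (F : fieldType) (n : nat) (g : 'I_n -> F) (o l : 'I_n) :
    'M[F]_n :=
  \matrix_(i, j) if j == l then g i else if (i == j) || (i == l) then g j
                 else g o.

(** A column [j] other than [l] is constantly [g o], with [g j - g o] added in rows [j] and [l]. *)
Lemma mul_fan_matrix (F : fieldType) (n : nat) (g : 'I_n -> F) (o l : 'I_n)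
    (v : 'rV[F]_n) (j : 'I_n) :
  (v *m fan_matrix g o l) 0 j =
  if j == l then \sum_i v 0 i * g i
  else g o * (\sum_i v 0 i) + (g j - g o) * (v 0 j + v 0 l).
Proof.
rewrite mxE; case: (eqVneq j l) => [->|jl].
  by apply: eq_bigr => i _; rewrite mxE eqxx.
(* Written as sums against Kronecker deltas, both coordinates let the identity be checked term by
   term. *)
rewrite -(sumr_mul_delta (v 0) j) -(sumr_mul_delta (v 0) l) -big_split /=.
rewrite !mulr_sumr -big_split /=; apply: eq_bigr => i _.
rewrite mxE (negbTE jl).
case: (eqVneq i j) => [->|_]; first by rewrite (negbTE jl) /=; ring.
by case: (eqVneq i l) => _ /=; ring.
Qed.

Lemma fan_matrix_unitP (F : fieldType) (n : nat) (g : 'I_n -> F) (o l : 'I_n) :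
  o != l -> g o != 0 ->
  fan_matrix g o l \in unitmx <->
  (forall k, k != o -> k != l -> g k != g o) /\
  g l != \sum_(k | (k != o) && (k != l)) g k - (n%:R - 3%:R) * g o.
Proof.
move=> ol go0; have lo : l != o by rewrite eq_sym.
have sum1 : \sum_(k < n | (k != o) && (k != l)) (1 : F) = n%:R - 2%:R.
  have := sum_ordD2 (fun=> 1 : F) ol.
  by rewrite sumr_const card_ord => ->; ring.
rewrite unitmx_kerP; split=> [ker0|[gk gl] v vG0].
  split=> [k ko kl|].
    apply/eqP => gko.
    (* If [g k = g o], rows [k] and [o] coincide, so the difference of their unit vectors is in the
       kernel. *)
    pose v : 'rV[F]_n := \row_i ((i == k)%:R - (i == o)%:R).
    have /rowP/(_ k) : v = 0.
      apply: ker0; apply/rowP => j; rewrite mul_fan_matrix [RHS]mxE.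
      have sumv h : \sum_i v 0 i * h i = h k - h o.
        rewrite -(sumr_mul_delta h k) -(sumr_mul_delta h o) -sumrB.
        by apply: eq_bigr => i _; rewrite mxE; ring.
      rewrite sumv gko subrr.
      have -> : \sum_i v 0 i = 0.
        by have := sumv (fun=> 1); rewrite subrr; under eq_bigr do rewrite mulr1.
      case: eqP => // _; rewrite !mxE [l == k]eq_sym (negbTE kl) (negbTE lo).
      case: (eqVneq j k) => [->|_]; first by rewrite gko; ring.
      by case: (eqVneq j o) => [->|_]; ring.
    by rewrite !mxE eqxx (negbTE ko) subr0 => /eqP; rewrite oner_eq0.
  apply/eqP => gle.
  (* The [n - 2] middle entries [-1] and the entry [1] at [l] force [n - 3] at [o] for a zero
     sum. *)
  pose v : 'rV[F]_n :=
    \row_i (if i == o then n%:R - 3%:R else if i == l then 1 else -1).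
  have /rowP/(_ l) : v = 0.
    apply: ker0; apply/rowP => j; rewrite mul_fan_matrix [RHS]mxE.
    have sumv h : \sum_i v 0 i * h i =
        (n%:R - 3%:R) * h o + h l - \sum_(k | (k != o) && (k != l)) h k.
      rewrite (sum_ordD2 _ ol) !mxE !eqxx (negbTE lo) mul1r -sumrN.
      congr (_ + _); apply: eq_bigr => i /andP[io il].
      by rewrite mxE (negbTE io) (negbTE il) mulN1r.
    have -> : \sum_i v 0 i = 0.
      have := sumv (fun=> 1); under eq_bigr do rewrite mulr1.
      by rewrite sum1 => ->; ring.
    rewrite sumv gle; case: (eqVneq j l) => [_|jl]; first by ring.
    rewrite !mxE eqxx (negbTE lo) (negbTE jl).
    by case: (eqVneq j o) => [->|_]; ring.
  by rewrite !mxE eqxx (negbTE lo) => /eqP; rewrite oner_eq0.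
have vG j : (v *m fan_matrix g o l) 0 j = 0 by rewrite vG0 mxE.
have s0 : \sum_i v 0 i = 0.
  (* In column [o] the coefficient [g j - g o] vanishes, leaving [g o] times the sum. *)
  have := vG o; rewrite mul_fan_matrix (negbTE ol) subrr mul0r addr0 => /eqP.
  by rewrite mulf_eq0 (negbTE go0) => /eqP.
have vk k : k != o -> k != l -> v 0 k = - v 0 l.
  move=> ko kl; have := vG k; rewrite mul_fan_matrix (negbTE kl) s0 mulr0 add0r.
  move/eqP; rewrite mulf_eq0 subr_eq0 (negbTE (gk _ ko kl)) /= addr_eq0.
  by move/eqP.
have sum_mid h : \sum_i v 0 i * h i =
    v 0 o * h o + v 0 l * h l
    - v 0 l * \sum_(k | (k != o) && (k != l)) h k.
  rewrite (sum_ordD2 _ ol) mulr_sumr -sumrN; congr (_ + _).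
  by apply: eq_bigr => i /andP[io il]; rewrite vk // mulNr.
have vo : v 0 o = (n%:R - 3%:R) * v 0 l.
  have := sum_mid (fun=> 1); under eq_bigr do rewrite mulr1.
  rewrite s0 sum1 => e.
  by apply/eqP; rewrite -subr_eq0; apply/eqP; rewrite [RHS]e; ring.
have vl : v 0 l = 0.
  (* All entries are now multiples of [v 0 l]; column [l] multiplies it by a factor that [gl] makes
     nonzero. *)
  have := vG l; rewrite mul_fan_matrix eqxx sum_mid vo => e.
  have /eqP : v 0 l * (g l - (\sum_(k | (k != o) && (k != l)) g k
                               - (n%:R - 3%:R) * g o)) = 0.
    by rewrite -[RHS]e; ring.
  by rewrite mulf_eq0 subr_eq0 (negbTE gl) orbF => /eqP.
apply/rowP => j; rewrite [RHS]mxE.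
case: (eqVneq j l) => [->//|jl]; case: (eqVneq j o) => [->|jo].
  by rewrite vo vl mulr0.
by rewrite vk // vl oppr0.
Qed.

Lemma unitmx_diag_congr (F : fieldType) (n : nat) (u : 'rV[F]_n) (A : 'M[F]_n) :
  (forall i, u 0 i != 0) ->
  (diag_mx u *m A *m diag_mx u \in unitmx) = (A \in unitmx).
Proof.
move=> u0; suff Du : diag_mx u \in unitmx by rewrite !unitmx_mul Du andbT.
by rewrite unitmxE det_diag unitfE; apply/prodf_neq0 => i _.
Qed.

Lemma semimultiplicative_join (d : Order.disp_t) (P : latticeType d)
    (F : fieldType) (f : P -> F) (x y : P) :
  semimultiplicative f -> f (Order.meet x y) != 0 ->
  f (Order.join x y) = f x * (f (Order.meet x y))^-1 * f y.
Proof. by move=> hf m0; rewrite mulrAC hf mulrAC mulfV ?mul1r. Qed.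

(** A [latticeType] carries no bottom, so the iterated join starts at some [a], which counts as one
    of the joined elements. *)
Lemma le_bigjoin_idx (d : Order.disp_t) (P : latticeType d) (I : Type)
    (r : seq I) (Q : pred I) (F : I -> P) (a : P) :
  (a <= \big[Order.join/a]_(i <- r | Q i) F i)%O.
Proof. by elim/big_rec: _ => // i y _ /le_trans; apply; exact: leUr. Qed.

Lemma le_bigjoin (d : Order.disp_t) (P : latticeType d) (I : eqType)
    (r : seq I) (Q : pred I) (F : I -> P) (a : P) (i : I) :
  i \in r -> Q i -> (F i <= \big[Order.join/a]_(j <- r | Q j) F j)%O.
Proof.
move=> + Qi; elim: r => // j r IHr; rewrite inE big_cons => /predU1P[<-|/IHr le].
  by rewrite Qi leUl.
by case: ifP => // _; apply: le_trans le (leUr _ _).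
Qed.

Theorem theorem5p2 (R : realType) (d : Order.disp_t) (P : latticeType d)
    (hP : finite_principal_ideals P)
    (f : P -> R[i])
    (hf : semimultiplicative f)
    (hf0 : forall x : P, f x <> 0)
    (n : nat) (hn : (3 <= n)%N)
    (x : 'I_n -> P)
    (hx : injective x)
    (hS : meet_closed_set (range x))
    (hord : forall i j : 'I_n, (x i < x j)%O -> (i < j)%N)
    (hmeet : forall i j : 'I_n, i <> last_ord hn -> j <> last_ord hn -> i <> j ->
       Order.meet (x i) (x j) = x (first_ord hn))
    (hjoin : (\big[Order.join/x (first_ord hn)]_(i < n
                 | (i != first_ord hn) && (i != last_ord hn)) x i
              <= x (last_ord hn))%O) :
  join_matrix f x \in unitmx <->
  (forall k : 'I_n, k <> first_ord hn -> k <> last_ord hn ->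
     f (x k) <> f (x (first_ord hn))) /\
  (f (x (last_ord hn)))^-1 <>
    (\sum_(k < n | (k != first_ord hn) && (k != last_ord hn)) (f (x k))^-1)
    - (n%:R - 3%:R) / f (x (first_ord hn)).
Proof.
move: hmeet hjoin; set o := first_ord hn; set l := last_ord hn => hmeet hjoin.
have ol : o != l.
  apply/eqP => /(congr1 val) /= e.
  by have := hn; case: (n) e => [|[|]].
have fN0 y : f y != 0 by apply/eqP.
(* In [hjoin], [x o] is the starting value of the join and the middle elements are its terms. *)
have xl i : (x i <= x l)%O.
  have [->|io] := eqVneq i o; first exact: le_trans (le_bigjoin_idx _ _ _ _) hjoin.
  have [->//|il] := eqVneq i l; apply: le_trans hjoin.
  by apply: le_bigjoin; rewrite ?mem_index_enum // io il.
have -> : join_matrix f x =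
    diag_mx (\row_i f (x i)) *m fan_matrix (fun i => (f (x i))^-1) o l
      *m diag_mx (\row_i f (x i)).
  apply/matrixP => i j; rewrite mul_mx_diag mul_diag_mx !mxE.
  rewrite semimultiplicative_join //; congr (_ * _ * _).
  (* The case order follows [fan_matrix]; each case computes the meet of [x i] and [x j]. *)
  have [->|/eqP jl] := eqVneq j l; first by rewrite (meet_l (xl i)).
  have [->|/eqP ij] := eqVneq i j; first by rewrite meetxx.
  have [->|/eqP il] := eqVneq i l; first by rewrite (meet_r (xl j)).
  by rewrite hmeet.
rewrite unitmx_diag_congr => [|i]; last by rewrite mxE.
rewrite fan_matrix_unitP ?invr_eq0 //.
split=> -[h1 h2]; split.
- move=> k /eqP ko /eqP kl e; move: (h1 k ko kl); by rewrite e eqxx.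
- by apply/eqP.
- move=> k ko kl; rewrite (inj_eq invr_inj); apply/eqP.
  by apply: h1; apply/eqP.
- by apply/eqP.
Qed.
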